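(* Let $n$ be a positive integer. For any collection $\{i_1,\ldots,i_k\}\subseteq\{1,\ldots,n\}$ of distinct indices, $k\le n$, and any $\alpha,\beta\in\mathscr{IO}_{\infty}(\mathbb{Z}^n_{\mathrm{lex}})$, one has $\alpha\,\sigma_{[i_1,\ldots,i_k]}\,\beta$ if and only if $$\alpha\,\varepsilon_{i_1}^\circ\cdots\varepsilon_{i_k}^\circ=\beta\,\varepsilon_{i_1}^\circ\cdots\varepsilon_{i_k}^\circ$$ for some idempotents $\varepsilon_{i_1}^\circ,\ldots,\varepsilon_{i_k}^\circ\in\mathscr{IO}_{\infty}(\mathbb{Z}^n_{\mathrm{lex}})$, where each $\varepsilon_{i_j}^\circ$ is an element having some idempotent $\varepsilon_{i_j}\in\mathscr{IO}_{\infty}(\mathbb{Z})$ as its $i_j$-th coordinate and the identity as every other coordinate.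
   Context: $L_n=\{1,\ldots,n\}$ with its usual order; $L_n\times_{\mathrm{lex}}\mathbb{Z}$ is $L_n\times\mathbb{Z}$ with the lexicographic order: $(i,m)\leqslant(j,l)$ iff $i<j$, or $i=j$ and $m\le l$. $\mathscr{IO}_{\infty}(\mathbb{Z}^n_{\mathrm{lex}})$ is the inverse monoid of all injective partial maps $\alpha$ from $L_n\times\mathbb{Z}$ to itself that are monotone ($x\leqslant y$ in $\operatorname{dom}\alpha$ implies $(x)\alpha\leqslant(y)\alpha$) and such that both $\operatorname{dom}\alpha$ and $\operatorname{ran}\alpha$ have finite complement in $L_n\times\mathbb{Z}$; the operation is composition of partial maps written on the right, $(x)(\alpha\beta)=((x)\alpha)\beta$. $\mathscr{IO}_{\infty}(\mathbb{Z})$ is the analogous monoid of injective monotone partial selfmaps of $\mathbb{Z}$ (usual order) with cofinite domain and image. Every element of $\mathscr{IO}_{\infty}(\mathbb{Z}^n_{\mathrm{lex}})$ preserves the first coordinate, so $\mathscr{IO}_{\infty}(\mathbb{Z}^n_{\mathrm{lex}})$ is identified with the direct power $(\mathscr{IO}_{\infty}(\mathbb{Z}))^n$ by $\alpha\leftrightarrow(\alpha_1,\ldots,\alpha_n)$, where $(i,k)\alpha=(i,(k)\alpha_i)$. For $\varepsilon\in\mathscr{IO}_{\infty}(\mathbb{Z})$ let $\varepsilon_i^\circ$ denote the element whose $i$-th coordinate is $\varepsilon$ and whose other coordinates are the identity. The congruence $\sigma_{[i]}$ is defined by: $\alpha\,\sigma_{[i]}\,\beta$ iff there exists an idempotent $\varepsilon\in\mathscr{IO}_{\infty}(\mathbb{Z})$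 such that $\alpha\varepsilon_i^\circ=\beta\varepsilon_i^\circ$. Further, $\sigma_{[i_1,\ldots,i_k]}=\sigma_{[i_1]}\circ\cdots\circ\sigma_{[i_k]}$, where $\circ$ is composition of binary relations ($\alpha(\rho\circ\tau)\beta$ iff $\alpha\rho\gamma$ and $\gamma\tau\beta$ for some $\gamma$). *)

(* Defs.v *)
From HB Require Import structures.
From mathcomp Require Import all_boot all_order all_algebra.
From mathcomp Require Import all_classical.

Set Implicit Arguments.
Unset Strict Implicit.
Unset Printing Implicit Defensive.

Import Order.TTheory GRing.Theory Num.Theory.

Local Open Scope classical_set_scope.

(* A partial selfmap of T is a function T -> option T; None means undefined. *)
Section PartialMaps.
Context {T : Type}.
Implicit Type f : T -> option T.

Definition pdom f : set T := [set x | exists y, f x = Some y].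
Definition pran f : set T := [set y | exists x, f x = Some y].

Definition pinjective f :=
  forall x1 x2 y, f x1 = Some y -> f x2 = Some y -> x1 = x2.

End PartialMaps.

Definition pmonotone d (T : porderType d) (f : T -> option T) :=
  forall x1 x2 y1 y2, f x1 = Some y1 -> f x2 = Some y2 ->
    (x1 <= x2)%O -> (y1 <= y2)%O.

Record IOinf d (T : porderType d) := MkIOinf {
  io_fun :> T -> option T;
  io_inj : pinjective io_fun;
  io_mono : pmonotone io_fun;
  io_dom : finite_set (~` pdom io_fun);
  io_ran : finite_set (~` pran io_fun) }.

Lemma IOinf_ext d (T : porderType d) (a b : IOinf T) : a =1 b -> a = b.
Proof.
case: a b => [f ? ? ? ?] [g ? ? ? ?] /= /funext fg; subst g.
congr MkIOinf; exact: Prop_irrelevance.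
Qed.

Section Monoid.
Context d (T : porderType d).
Implicit Types a b c : IOinf T.

Lemma pdomNone (U : Type) (f : U -> option U) x : (~` pdom f) x <-> f x = None.
Proof.
split=> [nfx|fx [y]]; last by rewrite fx.
by case fx: (f x) => [y|//]; case: nfx; exists y.
Qed.

Fact io_one_inj : pinjective (@Some T).
Proof. by move=> x1 x2 y [->] [->]. Qed.

Fact io_one_mono : pmonotone (@Some T).
Proof. by move=> x1 x2 y1 y2 [->] [->]. Qed.

Fact io_one_dom : finite_set (~` pdom (@Some T)).
Proof. by apply: sub_finite_set (finite_set0 T) => x /pdomNone. Qed.

Fact io_one_ran : finite_set (~` pran (@Some T)).
Proof. by apply: sub_finite_set (finite_set0 T) => y []; exists y. Qed.

Definition io_one : IOinf T :=
  MkIOinf io_one_inj io_one_mono io_one_dom io_one_ran.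

(* Maps act on the right: x (a b) = (x a) b, so a is applied first. *)
Definition io_mul_fun a b : T -> option T := fun x => obind b (a x).

Lemma io_mul_funP a b x z : io_mul_fun a b x = Some z ->
  exists2 y, a x = Some y & b y = Some z.
Proof. by rewrite /io_mul_fun; case ax: (a x) => [y|//] /= by_; exists y. Qed.

Fact io_mul_inj a b : pinjective (io_mul_fun a b).
Proof.
move=> x1 x2 z /io_mul_funP[y1 a1 b1] /io_mul_funP[y2 a2 b2].
by move: a2; rewrite -(io_inj b1 b2) => a2; exact: io_inj a1 a2.
Qed.

Fact io_mul_mono a b : pmonotone (io_mul_fun a b).
Proof.
move=> x1 x2 z1 z2 /io_mul_funP[y1 a1 b1] /io_mul_funP[y2 a2 b2] x12.
exact: io_mono b1 b2 (io_mono a1 a2 x12).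
Qed.

Fact io_mul_dom a b : finite_set (~` pdom (io_mul_fun a b)).
Proof.
have Fb : finite_set [set x | exists2 y, a x = Some y & (~` pdom b) y].
  apply: (@sub_finite_set _ _
    ((fun y => xget y [set x | a x = Some y]) @` (~` pdom b))).
    move=> x [y axy nby]; exists y => //.
    by case: xgetP => [x' _ /= ax'|/(_ x)]; [exact: io_inj ax' axy | case].
  exact: finite_image (io_dom b).
have F : finite_set (~` pdom a `|` [set x | exists2 y, a x = Some y &
    (~` pdom b) y]).
  by rewrite finite_setU; split; [exact: io_dom|].
apply: sub_finite_set F => x /pdomNone; rewrite /io_mul_fun.
case ax: (a x) => [y|] /= by_; last by left; apply/pdomNone.
by right; exists y => //; apply/pdomNone.
Qed.

Fact io_mul_ran a b : finite_set (~` pran (io_mul_fun a b)).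
Proof.
have Fa := finite_image (fun y => odflt y (b y)) (io_ran a).
have F : finite_set (~` pran b `|`
    (fun y => odflt y (b y)) @` (~` pran a)).
  by rewrite finite_setU; split; [exact: io_ran|].
apply: sub_finite_set F => z nz.
have [[y byz]|] := pselect (pran b z); last by left.
right; exists y; last by rewrite byz.
by move=> [x axy]; apply: nz; exists x; rewrite /io_mul_fun axy.
Qed.

Definition io_mul a b : IOinf T :=
  MkIOinf (@io_mul_inj a b) (@io_mul_mono a b) (io_mul_dom a b)
          (io_mul_ran a b).

Fact io_mulA : associative io_mul.
Proof.
move=> a b c; apply: IOinf_ext => x; rewrite /= /io_mul_fun /=.
by rewrite /io_mul_fun; case: (a x).
Qed.

Fact io_mul1 : left_id io_one io_mul.
Proof. by move=> a; apply: IOinf_ext. Qed.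

Fact io_mulr1 : right_id io_one io_mul.
Proof.
by move=> a; apply: IOinf_ext => x; rewrite /= /io_mul_fun; case: (a x).
Qed.

HB.instance Definition _ := gen_eqMixin (IOinf T).
HB.instance Definition _ := gen_choiceMixin (IOinf T).
HB.instance Definition _ := isMonoid.Build (IOinf T) io_mulA io_mul1 io_mulr1.

End Monoid.

(* 'I_n = {0, ..., n-1} with its usual order stands for L_n = {1, ..., n}. *)
Notation IO_Z := (IOinf int).
Notation IO_Zlex n := (IOinf ('I_n *l int)).

Definition idempotent_elt (G : magmaType) (e : G) : Prop := (e * e)%g = e.

(* The element of IO_Zlex n corresponding to (a_1, ..., a_n) in the direct
   power of IO_Z: (i, k) is sent to (i, (k) a_i). *)
Section Tuple.
Context (n : nat) (a : 'I_n -> IO_Z).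
Notation T := ('I_n *l int).

Definition io_tuple_fun : T -> option T :=
  fun x => omap (fun m => (x.1, m) : T) (a x.1 x.2).

Lemma io_tuple_funP x y : io_tuple_fun x = Some y <->
  y.1 = x.1 /\ a x.1 x.2 = Some y.2.
Proof.
case: x y => [i k] [j l]; rewrite /io_tuple_fun /=.
case: (a i k) => [m|] /=; last by split=> [|[]].
by split=> [[-> ->]|[-> [->]]].
Qed.

Fact io_tuple_inj : pinjective io_tuple_fun.
Proof.
move=> [i1 k1] [i2 k2] y /io_tuple_funP[/= e1 a1] /io_tuple_funP[/= e2].
by rewrite -e2 e1 => a2; rewrite (io_inj a1 a2).
Qed.

Fact io_tuple_mono : pmonotone io_tuple_fun.
Proof.
move=> [i1 k1] [i2 k2] [j1 l1] [j2 l2] /io_tuple_funP[/= -> a1].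
move=> /io_tuple_funP[/= -> a2]; rewrite !leEprodlexi /=.
case/andP=> i12 /implyP k12; rewrite i12; apply/implyP => i21.
have i_eq : i1 = i2 by apply/le_anti; rewrite i12 i21.
by move: a2 (k12 i21); rewrite -i_eq => a2; exact: io_mono a1 a2.
Qed.

Fact io_tuple_finite (P : 'I_n -> set int) : (forall i, finite_set (P i)) ->
  finite_set [set x : T | P x.1 x.2].
Proof.
move=> Pfin; apply: (@sub_finite_set _ _
  (\bigcup_(i in [set: 'I_n]) ((fun k => (i, k) : T) @` P i))).
  by move=> [i k] /= Pik; exists i => //; exists k.
by apply: bigcup_finite => [|i _]; [exact: finite_finset | exact: finite_image].
Qed.

Fact io_tuple_dom : finite_set (~` pdom io_tuple_fun).
Proof.
apply: sub_finite_set (io_tuple_finite (fun i => io_dom (a i))).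
move=> [i k] nx [l al]; apply: nx; exists (i, l).
by apply/io_tuple_funP.
Qed.

Fact io_tuple_ran : finite_set (~` pran io_tuple_fun).
Proof.
apply: sub_finite_set (io_tuple_finite (fun i => io_ran (a i))).
move=> [i l] ny [k ak]; apply: ny; exists (i, k).
by apply/io_tuple_funP.
Qed.

Definition io_tuple : IO_Zlex n :=
  MkIOinf io_tuple_inj io_tuple_mono io_tuple_dom io_tuple_ran.

End Tuple.

Definition io_circ n (i : 'I_n) (e : IO_Z) : IO_Zlex n :=
  io_tuple (fun j => if j == i then e else 1%g).

Definition sigma n (i : 'I_n) (a b : IO_Zlex n) : Prop :=
  exists2 e : IO_Z, idempotent_elt e & (a * io_circ i e = b * io_circ i e)%g.

Definition rel_comp (X : Type) (R S : X -> X -> Prop) : X -> X -> Prop :=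
  fun x z => exists y, R x y /\ S y z.

(* sigma (i 0) o ... o sigma (i (k-1)), in this order; the unit of the
   composition of relations is equality. *)
Definition sigmas n k (i : 'I_k -> 'I_n) : IO_Zlex n -> IO_Zlex n -> Prop :=
  \big[@rel_comp (IO_Zlex n)/@eq (IO_Zlex n)]_(j < k) sigma (i j).

(* Main.v *)
(** An element [a] of [IO_Zlex n] preserves rows: between two points of
    different rows lie infinitely many points of the domain, and they cannot be
    injected into an interval of a single row, so [a] is strictly increasing on
    rows; a strictly increasing selfmap of a finite chain is the identity.
    Hence rows of two elements can be exchanged freely. If
    [a e_0 P = b e_0 P], with [e_0] living on row [i_0] and [P] on the other
    rows, then the element [c] that agrees with [b] on row [i_0] and with [a]
    elsewhere satisfies [a e_0 = c e_0] and [c P = b P], which splits off the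
    first factor of the composition. Conversely [e_0] and [P] commute. *)
Require Import Defs.
From mathcomp Require Import all_boot all_order all_algebra.
From mathcomp Require Import all_classical.
From mathcomp Require Import zify.

Set Implicit Arguments.
Unset Strict Implicit.
Unset Printing Implicit Defensive.

Import Order.TTheory GRing.Theory Num.Theory.

Local Open Scope classical_set_scope.

(** * Intervals and rays of integers *)

Lemma finite_int_interval (p q : int) :
  finite_set [set m : int | (p <= m <= q)%R].
Proof.
apply: (@sub_finite_set _ _
  ((fun j : nat => p + j%:Z)%R @` `I_(absz (q - p)%R).+1)).
  by move=> m /= /andP[pm mq]; exists (absz (m - p)%R); lia.
exact/finite_image/finite_II.
Qed.

Lemma infinite_int_ray (p : int) : infinite_set [set m : int | (p < m)%R].
Proof.
move=> fin; apply: infinite_nat.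
apply: (@sub_finite_set _ _
  ((fun m : int => absz (m - p - 1)%R) @` [set m : int | (p < m)%R])).
  by move=> j _; exists (p + 1 + j%:Z)%R => /=; lia.
exact: finite_image.
Qed.

Section Rows.
Variable n : nat.
Implicit Types a b : IO_Zlex n.

(** * Preservation of rows *)

Lemma infinite_row (r : 'I_n) (p : int) :
  infinite_set [set x : 'I_n *l int | x.1 = r /\ (p < x.2)%R].
Proof.
move=> fin; apply: (@infinite_int_ray p).
apply: (sub_finite_set _ (finite_image (fun x : 'I_n *l int => x.2) fin)).
by move=> m pm; exists (r, m).
Qed.

Lemma row_dom a (r : 'I_n) : exists m y, a (r, m) = Some y.
Proof.
apply: contrapT => no; apply: (@infinite_row r 0%R).
apply: sub_finite_set (io_dom a) => -[r' m] /= [-> _] [y axy].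
by apply: no; exists m, y.
Qed.

Lemma row_ltn a x x' y y' : a x = Some y -> a x' = Some y' ->
  (x.1 < x'.1)%N -> (y.1 < y'.1)%N.
Proof.
move=> axy axy' xx'; rewrite ltnNge; apply/negP => y'y.
(* As [y'] is not in a later row than [y], every point between [y] and [y'] lies in the finite set
   [B]. *)
pose B : set ('I_n *l int) := [set z | z.1 = y.1 /\ (y.2 <= z.2 <= y'.2)%R].
have finB : finite_set B.
  apply: (sub_finite_set _
    (finite_image (fun m => (y.1, m) : 'I_n *l int) (finite_int_interval y.2 y'.2))).
  by rewrite /B => -[r m] /= [-> ym]; exists m.
have finA : finite_set [set z | exists2 w, a z = Some w & B w].
  (* [xget] picks a preimage; by injectivity of [a] it is the only one, so the preimage of [B] is
     finite. *)
  apply: (sub_finite_set _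
    (finite_image (fun w => xget w [set z | a z = Some w]) finB)).
  move=> z [w azw Bw]; exists w => //.
  by case: xgetP => [z' _ /= az'|/(_ z)]; [exact: io_inj az' azw|case].
apply: (@infinite_row x.1 x.2).
have: finite_set (~` pdom a `|` [set z | exists2 w, a z = Some w & B w]).
  by rewrite finite_setU; split; [exact: io_dom|].
apply: sub_finite_set => -[r m] /= [-> xm].
case azw: (a (x.1, m)) => [w|]; last by left; apply/pdomNone.
right; exists w => //; rewrite /B /=.
(* The point [(x.1, m)] lies between [x] and [x'], so its image [w] lies between [y] and [y']. *)
have /(io_mono axy azw) : (x <= ((x.1, m) : 'I_n *l int))%O.
  by case: x xm {axy xx' azw} => r0 m0 /= xm; rewrite leEprodlexi /= lexx ltW.
have /(io_mono azw axy') : (((x.1, m) : 'I_n *l int) <= x')%O.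
  case: x' xx' {axy'} => r0 m0 /= xx'; rewrite leEprodlexi /=.
  by rewrite !leEord (ltnW xx') leqNgt xx'.
case: y w y' y'y {axy azw axy' B finB finA} => [j l] [j1 l1] [j2 l2] /= y'y.
rewrite !leEprodlexi /= !leEord => /andP[h1 /implyP h2] /andP[h3 /implyP h4].
have e : j1 = j by apply: val_inj => /=; lia.
split=> //; apply/andP; split; first by apply: h4; rewrite e.
by apply: h2; rewrite e.
Qed.

(** Two inductions with [row_ltn], each comparing with a domain point of an adjacent row: counting
    rows from the first one gives [x.1 <= y.1], counting from the last one gives the converse. *)
Lemma row_preserved a x y : a x = Some y -> y.1 = x.1.
Proof.
have up m : forall x y, a x = Some y -> nat_of_ord x.1 = m -> (m <= y.1)%N.
  elim: m => [//|m IH] {}x {}y axy xm.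
  have mn : (m < n)%N by have := ltn_ord x.1; lia.
  have [p [z az]] := row_dom a (Ordinal mn).
  have := IH _ _ az erefl; have := row_ltn az axy; rewrite /= xm ltnSn => /(_ isT).
  lia.
(* Here [m] is the number of rows after the row of [x]. *)
have down m : forall x y, a x = Some y -> (x.1 + m.+1)%N = n ->
    (y.1 + m.+1 <= n)%N.
  elim: m => [|m IH] {}x {}y axy xm; first by rewrite addn1; exact: ltn_ord.
  have mn : (x.1.+1 < n)%N by lia.
  have [p [z az]] := row_dom a (Ordinal mn).
  have := IH _ _ az; rewrite /= addSnnS => /(_ xm); apply: leq_trans.
  by rewrite -addSnnS leq_add2r; apply: row_ltn axy az _.
move=> axy; apply: val_inj => /=.
have xn := ltn_ord x.1; have := down (n - x.1.+1)%N _ _ axy.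
rewrite subnSK // subnKC ?(ltnW xn) // => /(_ erefl) yx.
apply/eqP; rewrite eqn_leq (up _ _ _ axy erefl) andbT.
by rewrite -(leq_add2r (n - x.1)) (subnKC (ltnW xn)).
Qed.

(** * Exchanging one row between two elements *)

Section Splice.
Variables (r : 'I_n) (b a : IO_Zlex n).

Definition splice_fun (x : 'I_n *l int) := if x.1 == r then b x else a x.

Fact splice_row x y : splice_fun x = Some y -> y.1 = x.1.
Proof. by rewrite /splice_fun; case: ifP => _ /row_preserved. Qed.

Fact splice_inj : pinjective splice_fun.
Proof.
move=> x1 x2 y h1 h2; have e := splice_row h1; rewrite (splice_row h2) in e.
by move: h1 h2; rewrite /splice_fun e; case: ifP => _; exact: io_inj.
Qed.

Fact splice_mono : pmonotone splice_fun.
Proof.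
move=> x1 x2 y1 y2 h1 h2; have [e|ne] := eqVneq x1.1 x2.1.
  by move: h1 h2; rewrite /splice_fun e; case: ifP => _; exact: io_mono.
move: (splice_row h1) (splice_row h2) ne => {h1 h2}.
case: x1 x2 y1 y2 => [i1 k1] [i2 k2] [j1 l1] [j2 l2] /= -> -> ne.
rewrite !leEprodlexi /= => /andP[le12 _]; rewrite le12 /=.
by apply/implyP => le21; rewrite eq_le le12 le21 in ne.
Qed.

Fact splice_dom : finite_set (~` pdom splice_fun).
Proof.
have: finite_set (~` pdom b `|` ~` pdom a).
  by rewrite finite_setU; split; exact: io_dom.
apply: sub_finite_set => x /pdomNone; rewrite /splice_fun.
by case: ifP => _ ?; [left|right]; apply/pdomNone.
Qed.

Fact splice_ran : finite_set (~` pran splice_fun).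
Proof.
have: finite_set (~` pran b `|` ~` pran a).
  by rewrite finite_setU; split; exact: io_ran.
(* A preimage of [y] under [b] or [a] lies in the row of [y], so [splice_fun] uses the same map
   there. *)
apply: sub_finite_set => y ny; have [yr|yr] := eqVneq y.1 r; [left|right];
  move=> [x xy]; apply: ny; exists x;
  by rewrite /splice_fun -(row_preserved xy) ?yr ?eqxx // (negbTE yr).
Qed.

Definition splice : IO_Zlex n :=
  MkIOinf splice_inj splice_mono splice_dom splice_ran.

End Splice.

(** * Factors acting on separate rows *)

Lemma io_mulE a b x : (a * b)%g x = obind b (a x).
Proof. by []. Qed.

Definition fixes_row a (r : 'I_n) := forall m, a (r, m) = Some (r, m).

Lemma fixes_row_circ (r j : 'I_n) (e : IO_Z) :
  r != j -> fixes_row (io_circ j e) r.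
Proof. by move=> rj m; rewrite /= /io_tuple_fun /= (negbTE rj). Qed.

Lemma fixes_row_prod k (f : 'I_k -> IO_Zlex n) (r : 'I_n) :
  (forall j, fixes_row (f j) r) -> fixes_row (\prod_(j < k) f j)%g r.
Proof.
move=> fr; elim/big_ind: _ => // x y xr yr m.
by rewrite io_mulE xr /= yr.
Qed.

Lemma obind_fixes_row a b x (r : 'I_n) :
  x.1 = r -> fixes_row b r -> obind b (a x) = a x.
Proof.
move=> xr br; case axy: (a x) => [[s m]|] //=.
by have /= -> := row_preserved axy; rewrite xr br.
Qed.

Lemma io_tupleM (u v : 'I_n -> IO_Z) :
  (io_tuple u * io_tuple v)%g = io_tuple (fun j => u j * v j)%g.
Proof.
apply: IOinf_ext => -[j m]; rewrite io_mulE /= /io_tuple_fun /= /io_mul_fun.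
by case: (u j m).
Qed.

Lemma io_circ_idem (j : 'I_n) (e : IO_Z) :
  idempotent_elt e -> idempotent_elt (io_circ j e).
Proof.
move=> ee; rewrite /idempotent_elt /io_circ io_tupleM; congr io_tuple.
by apply/funext => l; case: ifP => _; rewrite ?mulg1.
Qed.

Lemma io_circ_commute (j l : 'I_n) (e f : IO_Z) : j != l ->
  (io_circ j e * io_circ l f)%g = (io_circ l f * io_circ j e)%g.
Proof.
move=> jl; rewrite /io_circ !io_tupleM; congr io_tuple; apply/funext => s.
case: (eqVneq s j) => [->|_]; last by rewrite mulg1 mul1g.
by rewrite (negbTE jl) mulg1 mul1g.
Qed.

Lemma io_circ_commute_prod k (j : 'I_n) (l : 'I_k -> 'I_n) (e : IO_Z)
    (f : 'I_k -> IO_Z) : (forall s, j != l s) ->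
  (io_circ j e * \prod_(s < k) io_circ (l s) (f s))%g =
  (\prod_(s < k) io_circ (l s) (f s) * io_circ j e)%g.
Proof.
move=> jl; apply: (big_ind (fun x => (io_circ j e * x = x * io_circ j e)%g)).
- by rewrite mulg1 mul1g.
- by move=> x y hx hy; rewrite mulgA hx -mulgA hy mulgA.
- by move=> s _; exact: io_circ_commute.
Qed.

(** Evaluate the hypothesis pointwise: on row [r] the factor [p] cancels, and on every other row
    [io_circ r e] does. The remaining cases hold because [splice] agrees there with the element it
    is compared to. *)
Lemma splice_split (r : 'I_n) (e : IO_Z) a b (p : IO_Zlex n) :
  fixes_row p r ->
  (a * (io_circ r e * p) = b * (io_circ r e * p))%g ->
  (a * io_circ r e = splice r b a * io_circ r e)%g /\
  (splice r b a * p = b * p)%g.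
Proof.
move=> pr; rewrite !mulgA => h.
split; apply: IOinf_ext => x;
  have hx : _ x = _ x := congr1 (fun u : IO_Zlex n => u x) h;
  rewrite 2!(io_mulE _ p) in hx; rewrite !io_mulE /= /splice_fun; case: ifP => // /eqP xr.
  by move: hx; rewrite !(obind_fixes_row _ xr pr) !io_mulE.
have cr : fixes_row (io_circ r e) x.1 by apply: fixes_row_circ; apply/eqP.
by move: hx; rewrite !io_mulE !(obind_fixes_row _ erefl cr).
Qed.

Lemma sigmas_circ k (i : 'I_k -> 'I_n) a b : injective i ->
  sigmas i a b <->
  exists2 eps : 'I_k -> IO_Z, (forall j, idempotent_elt (eps j)) &
    (a * \prod_(j < k) io_circ (i j) (eps j) =
     b * \prod_(j < k) io_circ (i j) (eps j))%g.
Proof.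
rewrite /sigmas; elim: k i a b => [|k IH] i a b i_inj.
  rewrite big_ord0; split=> [->|[eps _]]; last by rewrite !big_ord0 !mulg1.
  by exists (fun=> 1%g) => // -[].
have ne j : i ord0 != i (lift ord0 j) by rewrite (inj_eq i_inj) neq_lift.
have {}IH a' b' := IH (fun j => i (lift ord0 j)) a' b' (inj_comp i_inj lift_inj).
rewrite big_ord_recl; split.
  move=> [c [[e0 e0e ac] /IH[eps epsP cb]]].
  (* [unlift ord0 j] is [None] exactly at [ord0], so this family is [e0] followed by [eps]. *)
  exists (fun j => oapp eps e0 (unlift ord0 j)).
    by move=> j; case: unlift => /=.
  rewrite !big_ord_recl unlift_none /=.
  under eq_bigr do rewrite liftK /=.
  (* With E the first factor and P the rest: a E P = c E P = c P E = b P E = b E P. *)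
  rewrite mulgA ac -mulgA (io_circ_commute_prod _ _ ne).
  by rewrite !mulgA cb.
move=> [eps epsP]; rewrite !big_ord_recl => h.
(* Injectivity of [i], through [ne], makes the remaining factors fix row [i ord0]. *)
have [] := splice_split (fixes_row_prod _) h.
  by move=> j; exact: fixes_row_circ.
set c := splice _ _ _ => ac cb; exists c; split; first by exists (eps ord0).
by apply/IH; exists (fun j => eps (lift ord0 j)).
Qed.

End Rows.

Theorem proposition2p15 (n : nat) (n_gt0 : (0 < n)%N)
    (k : nat) (k_gt0 : (0 < k)%N) (k_le_n : (k <= n)%N)
    (i : 'I_k -> 'I_n) (i_inj : injective i)
    (a b : IO_Zlex n) :
  sigmas i a b <->
  exists e : 'I_k -> IO_Zlex n,
    (forall j : 'I_k, idempotent_elt (e j) /\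
       exists2 eps : IO_Z, idempotent_elt eps & e j = io_circ (i j) eps) /\
    (a * \prod_(j < k) e j = b * \prod_(j < k) e j)%g.
Proof.
rewrite sigmas_circ //; split=> [[eps epsP ab]|[e [eP ab]]].
  exists (fun j => io_circ (i j) (eps j)); split=> // j.
  by split; [exact: io_circ_idem|exists (eps j)].
have /choice[eps epsP] j : exists eps : IO_Z,
    idempotent_elt eps /\ e j = io_circ (i j) eps.
  by have [_ [f]] := eP j; exists f.
exists eps => [j|]; first by have [] := epsP j.
by under eq_bigr do rewrite -(epsP _).2.
Qed.
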